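(* Consider the Markov-modulated $(s,S)$ retrial inventory process described in the context, assumed positive recurrent, with steady-state mean total cost per unit time $C_T(s,S)$ as defined in the context, and cost coefficients $C_h=5$, $C_b=24$, $C_o=11$, $C_p=2$. Fix a non-negative integer $a$ and let $$\mathcal{F}_a=\{(s,S)\in\mathbb{Z}_{\ge 0}^2 : s=a,\ S\ge s+1\}.$$ Then the unique optimal solution $(s^*,S^* )$ of the problem of minimizing $C_T(s,S)$ subject to $(s,S)\in\mathcal{F}_a$ is $$(s^*,S^* )=\arg\min\big\{\,C_T\big(a,\max\{a+1,\lfloor \bar S\rfloor\}\big),\ C_T\big(a,\lceil\bar S\rceil\big)\big\},\qquad \bar S=a+\sqrt{\frac{2C_o}{C_hW}},$$ that is, $(s^*,S^* )$ is whichever of the two points $(a,\max\{a+1,\lfloor\bar S\rfloor\})$ and $(a,\lceil\bar S\rceil)$ has the smaller value of $C_T$.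
   Context: Model. Fix an integer $m\ge 1$ and inventory thresholds, integers $0\le s<S$. The random environment is an irreducible continuous-time Markov chain on $\{1,\dots,m\}$ with infinitesimal generator $Q=[q_{zz'}]$; put $q_z=-q_{zz}=\sum_{z'\ne z}q_{zz'}$. For each environment state $z$ there are positive exponential rates: $\lambda_z$ (demand arrival), $\mu_z$ (service), $\xi_z$ (server failure), $\alpha_z$ (server repair), $\theta_z$ (retrial rate per orbiting demand). The environment and rates are fixed; the thresholds $s,S$ are the decision variables. The process $\Phi=\{(R(t),I(t),X(t),Z(t)):t\ge 0\}$ is the continuous-time Markov chain with state space $\{(R,I,X,Z): R\in\mathbb{Z}_{\ge 0},\ I\in\{s+1,\dots,S\},\ X\in\{\iota,\beta,\gamma\},\ Z\in\{1,\dots,m\}\}$, where $R$ is the number of demands in orbit, $I$ the number of items in inventory, $X$ the server status ($\iota$ idle, $\beta$ busy, $\gamma$ failed), and $Z$ the environment state. Its only off-diagonal transitions with possibly nonzero rates are, for all $R\ge 0$, $I\in\{s+1,\dots,S\}$, $Z\in\{1,\dots,m\}$ (unless restricted): - $(R,I,\iota,Z)\to(R-1,I,\beta,Z)$ at rate $R\theta_Z$ ($R\ge1$; successful retrial); - $(R,I,X,Z)\to(R,I,X,Z')$ at rate $q_{ZZ'}$, for each $X\in\{\iota,\beta,\gamma\}$ and $Z'\ne Z$ (environment change); - $(R,I,\iota,Z)\to(R,I,\beta,Z)$ at rate $\lambda_Z$ (arrival while idle); - $(R,I,\iota,Z)\to(R,I,\gamma,Z)$ at rate $\xi_Z$ (failure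 while idle); - $(R,I,\beta,Z)\to(R,I-1,\iota,Z)$ at rate $\mu_Z$ if $I-1>s$ (service completion); - $(R,s+1,\beta,Z)\to(R,S,\iota,Z)$ at rate $\mu_Z$ (service completion with instantaneous replenishment); - $(R,I,\gamma,Z)\to(R,I,\iota,Z)$ at rate $\alpha_Z$ (repair); - $(R,I,\beta,Z)\to(R+1,I,\gamma,Z)$ at rate $\xi_Z$ (failure while busy); - $(R,I,\beta,Z)\to(R+1,I,\beta,Z)$ at rate $\lambda_Z$ (arrival while busy); - $(R,I,\gamma,Z)\to(R+1,I,\gamma,Z)$ at rate $\lambda_Z$ (arrival while failed). Performance measures (for positive recurrent $\Phi$). Let $P(R,i,x,z)$ denote the steady-state probabilities of $\Phi$. Put $p_R=\sum_{i=s+1}^S\sum_{x\in\{\iota,\beta,\gamma\}}\sum_{z=1}^m P(R,i,x,z)$ and $p_\beta=\sum_{R\ge0}\sum_{i=s+1}^S\sum_{z=1}^m P(R,i,\beta,z)$. Then $L_R=\sum_{R\ge 0}R\,p_R$ (mean orbit size), $L=L_R+p_\beta$ (mean number in system), and $W=L/\bar\lambda$, where $\bar\lambda=\sum_{z=1}^m\lambda_zp_z$ and $(p_z)_{z=1}^m$ is the stationary probability vector of $Q$. The quantities $L_R$ and $W$ do not depend on $s$ or $S$. The mean inventory level is $B_{inv}=\tfrac12(s+S+1)$, the ordering rate is $r_o=\frac{1}{(S-s)W}$, and the supply rate is $r_s=\frac1W$. Cost function. $C_h$ is the holding cost per item per unit time, $C_b$ the blocking cost per item in orbit per unit time, $C_o$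 the reordering cost per order, $C_p$ the purchase cost per item, and $$C_T(s,S)=C_hB_{inv}+C_bL_R+C_or_o+C_pr_s=\frac{C_h}{2}(S+s+1)+C_bL_R+\frac1W\Big(C_p+\frac{C_o}{S-s}\Big).$$
   Formalization: Uniqueness of the optimal solution is claimed only when the two candidate points coincide or have different costs, since distinct candidates can tie and both be optimal; in every case the optimal solutions are exactly the cheaper of the two candidates (both in a tie). *)

(* Defs.v *)
From HB Require Import structures.
From mathcomp Require Import all_boot all_order all_algebra.
From mathcomp Require Import all_classical all_reals all_analysis.

Set Implicit Arguments.
Unset Strict Implicit.
Unset Printing Implicit Defensive.

Import Order.TTheory GRing.Theory Num.Theory.

Local Open Scope classical_set_scope.
Local Open Scope ring_scope.

(* A continuous-time Markov chain on T is given by its off-diagonal rates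
   q x y (x != y); the values q x x are never used. *)
Section CTMC.
Context {R : realType} {T : choiceType}.
Variable q : T -> T -> R.

Definition exit_rate (x : T) : R :=
  fine (\esum_(y in ~` [set x]) (q x y)%:E)%E.

Definition jump_prob (x y : T) : R :=
  if y == x then 0 else q x y / exit_rate x.

(* Probability that the jump chain started at x is at y after n jumps and has
   not revisited x during the jumps 1, ..., n. *)
Fixpoint taboo_prob (x : T) (n : nat) (y : T) : \bar R :=
  if n is n'.+1 then
    if y == x then 0%E
    else (\esum_(w in [set: T]) (taboo_prob x n' w * (jump_prob w y)%:E))%E
  else if y == x then 1%E else 0%E.

(* Probability that the first return to x happens at jump n.+1. *)
Definition first_return_prob (x : T) (n : nat) : \bar R :=
  (\esum_(w in [set: T]) (taboo_prob x n w * (jump_prob w x)%:E))%E.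

Definition return_prob (x : T) : \bar R :=
  (\sum_(0 <= n <oo) first_return_prob x n)%E.

(* Expectation of the sum of the holding times (of mean 1 / exit_rate y in
   state y) up to the first return to x; it is the mean return time when the
   return has probability 1. *)
Definition mean_return_time (x : T) : \bar R :=
  (\sum_(0 <= n <oo)
     \esum_(y in [set: T]) (taboo_prob x n y * ((exit_rate y)^-1)%:E))%E.

Definition positive_recurrent (x : T) : Prop :=
  return_prob x = 1%E /\ (mean_return_time x < +oo)%E.

(* Probability vector carried by D that solves the global balance equations. *)
Definition steady_state (D : set T) (P : T -> R) : Prop :=
  [/\ forall x, 0 <= P x,
      forall x, ~ D x -> P x = 0,
      (\esum_(x in [set: T]) (P x)%:E)%E = 1%E &
      forall y, (P y * exit_rate y)%:E =
                (\esum_(x in ~` [set y]) (P x * q x y)%:E)%E].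

End CTMC.

Definition infinitesimal_generator (R : realType) (m : nat) (Q : 'M[R]_m) :=
  (forall z z', z != z' -> 0 <= Q z z') /\ (forall z, \sum_z' Q z z' = 0).

Definition irreducible_generator (R : realType) (m : nat) (Q : 'M[R]_m) :=
  forall z z', connect (fun u v => 0 < Q u v) z z'.

Definition stationary_vector (R : realType) (m : nat) (Q : 'M[R]_m)
    (p : 'rV[R]_m) : Prop :=
  [/\ forall z, 0 <= p 0 z, \sum_z p 0 z = 1 & p *m Q = 0].

Inductive server := idle | busy | failed.

Definition server_code (x : server) : option bool :=
  match x with idle => None | busy => Some true | failed => Some false end.
Definition server_decode (c : option bool) : server :=
  match c with None => idle | Some true => busy | Some false => failed end.
Lemma server_codeK : cancel server_code server_decode.
Proof. by case. Qed.
HB.instance Definition _ := Finite.copy server (can_type server_codeK).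

Record environment (R : realType) (m : nat) := Environment {
  env_gen : 'M[R]_m;
  arrival : 'I_m -> R;
  service : 'I_m -> R;
  failure : 'I_m -> R;
  repair : 'I_m -> R;
  retrial : 'I_m -> R }.

Definition valid_environment (R : realType) (m : nat)
    (e : environment R m) : Prop :=
  [/\ infinitesimal_generator (env_gen e),
      irreducible_generator (env_gen e) &
      forall z, [/\ 0 < arrival e z, 0 < service e z, 0 < failure e z,
                    0 < repair e z & 0 < retrial e z]].

(* (number in orbit, inventory level, server status, environment state) *)
Definition state (m : nat) : Type := (nat * nat * server * 'I_m)%type.

Definition state_space (s S m : nat) : set (state m) :=
  [set x : state m | let: (_, i, _, _) := x in (s < i <= S)%N].

(* Off-diagonal transition rates; b%:R is the indicator of the boolean b. *)
Definition rate (R : realType) (m : nat) (e : environment R m) (s S : nat)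
    (x y : state m) : R :=
  let: (r, i, st, z) := x in
  if (s < i <= S)%N then
    (\sum_(z' | z' != z) env_gen e z z' * (y == (r, i, st, z'))%:R) +
    match st with
    | idle =>
        r%:R * retrial e z * ((0 < r)%N && (y == (r.-1, i, busy, z)))%:R
        + arrival e z * (y == (r, i, busy, z))%:R
        + failure e z * (y == (r, i, failed, z))%:R
    | busy =>
        service e z * ((s.+1 < i)%N && (y == (r, i.-1, idle, z)))%:R
        + service e z * ((i == s.+1) && (y == (r, S, idle, z)))%:R
        + failure e z * (y == (r.+1, i, failed, z))%:R
        + arrival e z * (y == (r.+1, i, busy, z))%:R
    | failed =>
        repair e z * (y == (r, i, idle, z))%:R
        + arrival e z * (y == (r.+1, i, failed, z))%:R
    end
  else 0.

Section Measures.
Context {R : realType} {m : nat}.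
Implicit Types (P : state m -> R) (s S : nat).

Definition orbit_prob s S P (r : nat) : R :=
  \sum_(s.+1 <= i < S.+1) \sum_(x : server) \sum_(z < m) P (r, i, x, z).

Definition busy_prob s S P : R :=
  fine (\sum_(0 <= r <oo)
    (\sum_(s.+1 <= i < S.+1) \sum_(z < m) P (r, i, busy, z))%:E)%E.

(* The series has nonnegative terms; positive recurrence forces it to be
   finite (the retrial rate grows linearly with the orbit size). *)
Definition mean_orbit_size s S P : R :=
  fine (\sum_(0 <= r <oo) (r%:R * orbit_prob s S P r)%:E)%E.

Definition mean_number s S P : R := mean_orbit_size s S P + busy_prob s S P.

Definition mean_arrival_rate (e : environment R m) (p : 'rV[R]_m) : R :=
  \sum_z arrival e z * p 0 z.

Definition mean_sojourn (e : environment R m) (p : 'rV[R]_m) s S P : R :=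
  mean_number s S P / mean_arrival_rate e p.

(* The steady state is a family PP s S indexed by the thresholds. *)
Definition total_cost (Ch Cb Co Cp : R) (e : environment R m) (p : 'rV[R]_m)
    (PP : nat -> nat -> state m -> R) (t : nat * nat) : R :=
  let s := t.1 in
  let S := t.2 in
  let W := mean_sojourn e p s S (PP s S) in
  let Binv := (s%:R + S%:R + 1) / 2 in
  let ro := 1 / ((S%:R - s%:R) * W) in
  let rs := 1 / W in
  Ch * Binv + Cb * mean_orbit_size s S (PP s S) + Co * ro + Cp * rs.

End Measures.

Definition feasible (a : nat) : set (nat * nat) :=
  [set t | t.1 = a /\ (t.1.+1 <= t.2)%N].

Definition argmin_set (R : realType) (T : Type) (f : T -> R) (A : set T) :
    set T :=
  [set t | A t /\ forall t', A t' -> f t <= f t'].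

(* Main.v *)
(* Summing the balance equations over the inventory level gives a chain on
   (orbit, server, environment) that does not involve the thresholds. This chain
   has at most one steady state: if [v] and [w] are two of them, the positive
   part of [v - w] is again balanced, and by irreducibility it vanishes or is
   positive everywhere; the latter contradicts the equality of total masses.
   Hence [L_R] and [W] do not depend on [(s, S)]. With [n = S - a], the cost is
   then [Ch / 2 * n + Co / W / n] up to a constant, and the sign of the
   difference of its values at [n] and [k] is that of
   [(n - k) * (n * k - 2 * Co / (Ch * W))]: outside the rounding points,
   the cost strictly decreases towards them. *)
Require Import Defs.
From HB Require Import structures.
From mathcomp Require Import all_boot all_order all_algebra.
From mathcomp Require Import all_classical all_reals all_analysis.
From mathcomp Require Import zify ring lra.

Set Implicit Arguments.
Unset Strict Implicit.
Unset Printing Implicit Defensive.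

Import Order.TTheory GRing.Theory Num.Theory.

Local Open Scope classical_set_scope.
Local Open Scope ring_scope.

Lemma sum_server (V : nmodType) (F : server -> V) :
  \sum_x F x = F idle + F busy + F failed.
Proof.
rewrite (bigD1 idle)//= (bigD1 busy)//= (bigD1 failed)//= big1 ?addr0 ?addrA//.
by case.
Qed.

(** * Balance and uniqueness for the chain on orbit size, server status and environment *)

Section Orbit_chain.
Context {R : realType} {m : nat} (e : environment R m).
Hypothesis he : valid_environment e.
Implicit Types (v w : nat -> server -> 'I_m -> R) (r : nat) (st : server).

Local Notation Q := (env_gen e).

Lemma gen_ge0 z z' : z != z' -> 0 <= Q z z'.
Proof. by case: he => -[+ _] _ _; apply. Qed.

Lemma arrival_gt0 z : 0 < arrival e z.
Proof. by case: he => _ _ /(_ z)[]. Qed.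

Lemma service_gt0 z : 0 < service e z.
Proof. by case: he => _ _ /(_ z)[]. Qed.

Lemma failure_gt0 z : 0 < failure e z.
Proof. by case: he => _ _ /(_ z)[]. Qed.

Lemma repair_gt0 z : 0 < repair e z.
Proof. by case: he => _ _ /(_ z)[]. Qed.

Lemma retrial_gt0 z : 0 < retrial e z.
Proof. by case: he => _ _ /(_ z)[]. Qed.

(** The boundary value 0 lets the balance equations at orbit size 0 share the form of the others. *)
Definition before v r st z : R := if r is r'.+1 then v r' st z else 0.

Definition outflow r st z : R :=
  \sum_(z' | z' != z) Q z z' +
  match st with
  | idle => r%:R * retrial e z + arrival e z + failure e z
  | busy => service e z + failure e z + arrival e z
  | failed => repair e z + arrival e z
  end.

Definition inflow v r st z : R :=
  \sum_(z' | z' != z) v r st z' * Q z' z +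
  match st with
  | idle => v r busy z * service e z + v r failed z * repair e z
  | busy => v r.+1 idle z * (r.+1%:R * retrial e z) + v r idle z * arrival e z
            + before v r busy z * arrival e z
  | failed => v r idle z * failure e z + before v r busy z * failure e z
            + before v r failed z * arrival e z
  end.

Definition balanced v :=
  forall r st z, v r st z * outflow r st z = inflow v r st z.

(* Net flow from the orbit sizes at least [r] to those below [r]. *)
Definition cut v r : R :=
  \sum_z (v r idle z * (r%:R * retrial e z)
          - before v r busy z * (failure e z + arrival e z)
          - before v r failed z * arrival e z).

Lemma outflow_gt0 r st z : 0 < outflow r st z.
Proof.
have [h1 h2] := (arrival_gt0 z, service_gt0 z).
have [h3 h4] := (failure_gt0 z, repair_gt0 z).
have h5 : 0 <= r%:R * retrial e z by rewrite mulr_ge0 ?ler0n// ltW ?retrial_gt0.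
rewrite /outflow ltr_wpDl//; last by case: st; lra.
by apply: sumr_ge0 => z' zz'; rewrite gen_ge0// eq_sym.
Qed.

Lemma le_inflow v w r st z :
  (forall r st z, v r st z <= w r st z) -> inflow v r st z <= inflow w r st z.
Proof.
move=> vw; have bvw st' : before v r st' z <= before w r st' z.
  by case: r => /=.
have h1 := ltW (arrival_gt0 z); have h2 := ltW (service_gt0 z).
have h3 := ltW (failure_gt0 z); have h4 := ltW (repair_gt0 z).
have h5 : 0 <= r.+1%:R * retrial e z.
  by rewrite mulr_ge0 ?ler0n// ltW ?retrial_gt0.
apply: lerD; first by apply: ler_sum => z' zz'; rewrite ler_wpM2r ?gen_ge0.
by case: st; rewrite !lerD// ler_wpM2r.
Qed.

Lemma inflow0 r st z : inflow (fun _ _ _ => 0) r st z = 0.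
Proof.
rewrite /inflow big1 ?add0r => [|z' _]; last by rewrite mul0r.
by case: r => [|r]; case: st => /=; rewrite !mul0r !addr0.
Qed.

Lemma inflow_ge0 v r st z :
  (forall r st z, 0 <= v r st z) -> 0 <= inflow v r st z.
Proof. by move=> v0; rewrite -(inflow0 r st z); exact: le_inflow. Qed.

Lemma cut0 v : cut v 0 = 0.
Proof. by rewrite /cut big1// => z _; rewrite /=; ring. Qed.

(** Server and environment changes at fixed orbit size cancel in the sum, so the net inflow into
    orbit size [r] is what crosses its two boundaries. *)
Lemma cutS v r :
  cut v r.+1 = cut v r +
    \sum_z \sum_st (inflow v r st z - v r st z * outflow r st z).
Proof.
(* The environment terms cancel only after summation over [z]. Adding [E st = 0] for each status
   makes the rest an identity for each [z] separately. *)
pose E st := \sum_z (\sum_(z' | z' != z) v r st z' * Q z' z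
                     - v r st z * \sum_(z' | z' != z) Q z z').
have E0 st : E st = 0.
  rewrite /E sumrB [X in X - _](exchange_big_dep predT)//=.
  apply/eqP; rewrite subr_eq0; apply/eqP; apply: eq_bigr => z _.
  by rewrite mulr_sumr; apply: eq_bigl => z'; rewrite eq_sym.
have -> : cut v r.+1 = cut v r + (cut v r.+1 - cut v r) by ring.
congr (_ + _); rewrite -[LHS](addr0) -[in LHS](E0 idle) -[LHS]addr0.
rewrite -[in LHS](E0 busy) -[LHS]addr0 -[in LHS](E0 failed) /E /cut -sumrB.
rewrite -!big_split/=; apply: eq_bigr => z _.
by rewrite sum_server /inflow /outflow /=; ring.
Qed.

Lemma balanced_cut v r : balanced v -> cut v r = 0.
Proof.
move=> bv; elim: r => [|r IH]; rewrite ?cut0// cutS IH add0r big1// => z _.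
by rewrite big1// => st _; rewrite bv subrr.
Qed.

Lemma balanced_gt0_inflow v r st z : balanced v ->
  0 < inflow v r st z -> 0 < v r st z.
Proof. by move=> bv; rewrite -bv pmulr_lgt0// outflow_gt0. Qed.

(** Irreducibility in terms of balance: a positive source of a transition makes the inflow of its
    target positive, hence the target too. Any two states are joined through the idle states at
    orbit size 0. *)
Lemma balanced_gt0 v : (forall r st z, 0 <= v r st z) -> balanced v ->
  forall r st z, 0 < v r st z -> forall r' st' z', 0 < v r' st' z'.
Proof.
move=> v0 bv.
have b0 r st z : 0 <= before v r st z by case: r => /=.
have env0 r st z : 0 <= \sum_(z' | z' != z) v r st z' * Q z' z.
  by apply: sumr_ge0 => z' zz'; rewrite mulr_ge0// gen_ge0.
have a0 z := ltW (arrival_gt0 z).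
have s0 z := ltW (service_gt0 z).
have f0 z := ltW (failure_gt0 z).
have p0 z := ltW (repair_gt0 z).
have t0 z := ltW (retrial_gt0 z).
have envP r st z z' : 0 < v r st z -> 0 < v r st z'.
  have /connectP[l] : connect (fun x y => 0 < Q x y) z z' 
    by case: he.
  elim: l z => [z _ ->//|z1 l IH z /= /andP[zz1 pl] lst vz].
  apply: (IH z1) => //; have [<-//|neq] := eqVneq z z1.
  apply: balanced_gt0_inflow => //; rewrite /inflow (bigD1 z)//= -addrA.
  rewrite ltr_pwDl ?mulr_gt0// addr_ge0//.
    by apply: sumr_ge0 => z2 /andP[? ?]; rewrite mulr_ge0// gen_ge0.
  by case: (st); rewrite ?addr_ge0 ?mulr_ge0.
have idle_busy r z : 0 < v r idle z -> 0 < v r busy z.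
  move=> vz; apply: balanced_gt0_inflow => //; rewrite /inflow ltr_wpDl//.
  by rewrite ltr_pwDl ?mulr_ge0// ltr_wpDl ?mulr_ge0// mulr_gt0 ?arrival_gt0.
have idle_failed r z : 0 < v r idle z -> 0 < v r failed z.
  move=> vz; apply: balanced_gt0_inflow => //; rewrite /inflow ltr_wpDl//.
  by rewrite !ltr_pwDl ?mulr_ge0// mulr_gt0 ?failure_gt0.
have busy_idle r z : 0 < v r busy z -> 0 < v r idle z.
  move=> vz; apply: balanced_gt0_inflow => //; rewrite /inflow ltr_wpDl//.
  by rewrite ltr_pwDl ?mulr_ge0// mulr_gt0 ?service_gt0.
have failed_idle r z : 0 < v r failed z -> 0 < v r idle z.
  move=> vz; apply: balanced_gt0_inflow => //; rewrite /inflow ltr_wpDl//.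
  by rewrite ltr_wpDl ?mulr_ge0// mulr_gt0 ?repair_gt0.
(* The orbit grows by an arrival while busy and shrinks by a retrial; a service completion then
   leads back to idle. *)
have up r z : 0 < v r idle z -> 0 < v r.+1 idle z.
  move=> /idle_busy vz; apply/busy_idle/balanced_gt0_inflow => //.
  rewrite /inflow ltr_wpDl//= ltr_wpDl ?addr_ge0 ?mulr_ge0//.
  by rewrite mulr_gt0 ?arrival_gt0.
have down r z : 0 < v r.+1 idle z -> 0 < v r idle z.
  move=> vz; apply/busy_idle/balanced_gt0_inflow => //.
  rewrite /inflow ltr_wpDl// -addrA ltr_pwDl ?addr_ge0 ?mulr_ge0//.
  by rewrite !mulr_gt0 ?retrial_gt0.
move=> r st z vz r' st' z'.
have {st}vz : 0 < v r idle z.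
  by case: st vz => // ?; [exact: busy_idle|exact: failed_idle].
have {vz}v0z : 0 < v 0%N idle z'.
  by apply: (envP _ _ z); elim: r vz => // r IH /down.
have : 0 < v r' idle z' by elim: r' => // r' /up.
by case: st' => // ?; [exact: idle_busy|exact: idle_failed].
Qed.

Definition level v r : R := \sum_z \sum_st v r st z.

(** If [u n] were positive, monotonicity would keep every later [w] at least [u n / C], so [k] terms
    would give [k * u n <= C * M]; the Archimedean bound [k] violates this. *)
Lemma nondecreasing_le0 (u w : nat -> R) (C M : R) :
  {homo u : i j / (i <= j)%N >-> i <= j} -> 0 < C ->
  (forall n, u n.+1 <= C * w n) -> (forall n, 0 <= w n) ->
  (forall n, \sum_(r < n) w r <= M) -> forall n, u n <= 0.
Proof.
move=> u_ C0 uw w0 wM n; rewrite leNgt; apply/negP => un.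
have M0 : 0 <= M by have := wM 0%N; rewrite big_ord0.
pose k := Num.bound (C * M / u n).
suff : k%:R * u n <= C * M.
  rewrite leNgt -ltr_pdivrMr//.
  by rewrite archi_boundP// divr_ge0 ?mulr_ge0 ?(ltW C0) ?(ltW un).
rewrite (@le_trans _ _ (C * \sum_(r < n + k) w r)) ?ler_wpM2l ?(ltW C0)//.
elim: (k) => [|j IH]; first by rewrite mul0r mulr_ge0 ?sumr_ge0 ?(ltW C0).
rewrite addnS big_ord_recr/= mulrDr -natr1 mulrDl mul1r lerD//.
by rewrite (le_trans _ (uw _))// u_// leqW// leq_addr.
Qed.

(* The positive part [h] of [v - w] receives at least as much flow as it emits.
   The excess accumulated below orbit size [r] must leave through the cut at
   [r], whose flow is at most a multiple of the mass of [v] at [r - 1] and so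
   vanishes in the limit: [h] is balanced. *)
Lemma balanced_max v w (M : R) :
  (forall r st z, 0 <= v r st z) -> (forall r st z, 0 <= w r st z) ->
  balanced v -> balanced w -> (forall n, \sum_(r < n) level v r <= M) ->
  balanced (fun r st z => Num.max (v r st z - w r st z) 0).
Proof.
move=> v0 w0 bv bw vM; set h := fun r st z => _.
have h0 r st z : 0 <= h r st z by rewrite /h le_max lexx orbT.
have hv r st z : h r st z <= v r st z.
  by rewrite /h ge_max v0 lerBlDr lerDl w0.
(* Where [h] is [v - w], the left side is [inflow v - inflow w], and [v <= h + w] bounds it by the
   inflow of [h]. *)
have bd r st z : h r st z * outflow r st z <= inflow h r st z.
  rewrite {1}/h maxr_pMl ?(ltW (outflow_gt0 _ _ _))// mul0r.
  rewrite ge_max inflow_ge0// andbT mulrBl bv bw lerBlDr.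
  have -> : inflow h r st z + inflow w r st z =
      inflow (fun r st z => h r st z + w r st z) r st z.
    rewrite /inflow addrACA -big_split/=; congr (_ + _).
      by apply: eq_bigr => z' _; rewrite mulrDl.
    by case: st; case: r => [|r] /=; ring.
  by apply: le_inflow => r' st' z'; rewrite -lerBlDr /h le_max lexx.
have d0 r st z : 0 <= inflow h r st z - h r st z * outflow r st z.
  by rewrite subr_ge0.
have cut_homo : {homo cut h : i j / (i <= j)%N >-> i <= j}.
  apply: homo_leq => //; [exact: le_trans|move=> r].
  by rewrite cutS lerDl sumr_ge0// => z _; rewrite sumr_ge0.
have cut_ge0 r : 0 <= cut h r by rewrite -(cut0 h) cut_homo.
have level_ge0 r : 0 <= level v r.
  by apply: sumr_ge0 => z _; apply: sumr_ge0.
(* [C] dominates every rate of increase of the orbit; the 1 keeps it positive whatever [m] is. *)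
pose C := 1 + \sum_z (failure e z + arrival e z).
have fa0 z : 0 <= failure e z + arrival e z.
  by rewrite addr_ge0// ltW ?failure_gt0 ?arrival_gt0.
have C0 : 0 < C by rewrite ltr_pwDl ?sumr_ge0.
(* Retrial rates are unbounded in [r], so the downward flow of [v] is not bounded by its mass
   directly. Since [cut v r.+1 = 0], it equals the upward flow from [r], whose rates are at most
   [C]. *)
have cut_le r : cut h r.+1 <= C * level v r.
  have -> : C * level v r = C * level v r + cut v r.+1.
    by rewrite balanced_cut ?addr0.
  rewrite /cut /level mulr_sumr -big_split/= ler_sum// => z _.
  have C1 : failure e z + arrival e z <= C.
    by rewrite /C (bigD1 z)//= addrCA lerDl addr_ge0// sumr_ge0.
  have := ler_wpM2r (v0 r busy z) C1.
  have C2 : arrival e z <= C by have := failure_gt0 z; lra.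
  have := ler_wpM2r (v0 r failed z) C2.
  have := mulr_ge0 (ltW C0) (v0 r idle z).
  have := mulr_ge0 (h0 r busy z) (fa0 z).
  have := mulr_ge0 (h0 r failed z) (ltW (arrival_gt0 z)).
  have t0 : 0 <= r.+1%:R * retrial e z.
    by rewrite mulr_ge0 ?ler0n// ltW// retrial_gt0.
  have := ler_wpM2r t0 (hv r.+1 idle z).
  by rewrite sum_server !mulrDr; lra.
have cut_eq0 r : cut h r = 0.
  apply/eqP; rewrite eq_le cut_ge0 andbT.
  exact: (nondecreasing_le0 cut_homo C0 cut_le level_ge0 vM).
(* With all cuts zero, the nonnegative excesses at orbit size [r] sum to zero, so each vanishes. *)
move=> r st z; apply/eqP; rewrite eq_sym -subr_eq0; apply/eqP.
have /eqP := cutS h r; rewrite !cut_eq0 add0r eq_sym.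
rewrite psumr_eq0 => [/allP/(_ z)/=|z' _]; last by rewrite sumr_ge0.
rewrite mem_index_enum => /(_ isT); rewrite psumr_eq0 => [/allP/(_ st)/=|//].
by rewrite mem_index_enum => /(_ isT)/eqP.
Qed.

(** If [v] exceeded [w] at one state, it would do so everywhere, and the mass of [w] would fall
    below 1 by at least the gap at orbit size 0. Total masses enter through partial sums only. *)
Lemma balanced_le v w :
  (forall r st z, 0 <= v r st z) -> (forall r st z, 0 <= w r st z) ->
  balanced v -> balanced w ->
  (forall n, \sum_(r < n) level v r <= 1) ->
  (forall eps, 0 < eps -> exists n, 1 - eps < \sum_(r < n) level w r) ->
  forall r st z, v r st z <= w r st z.
Proof.
move=> v0 w0 bv bw v1 w1 r st z; rewrite leNgt; apply/negP => vw.
pose h r st z := Num.max (v r st z - w r st z) 0.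
have h0 r' st' z' : 0 <= h r' st' z' by rewrite /h le_max lexx orbT.
have hr : 0 < h r st z by rewrite /h lt_max subr_gt0 vw.
have bh : balanced h by exact: balanced_max v1.
have wv r' st' z' : w r' st' z' < v r' st' z'.
  have := balanced_gt0 h0 bh hr r' st' z'.
  by rewrite /h lt_max ltxx orbF subr_gt0.
have lev_le k : level w k <= level v k.
  by apply: ler_sum => z' _; apply: ler_sum => st' _; exact/ltW.
have lev_lt : level w 0 < level v 0.
  rewrite /level; apply: ltr_sum => [|z' _].
    by apply/hasP; exists z; rewrite ?mem_index_enum.
  by rewrite !sum_server !ltrD.
have [|n] := w1 (level v 0 - level w 0); first by rewrite subr_gt0.
have -> : (1 - (level v 0 - level w 0) < \sum_(i < n) level w i) = false => //.
apply: negbTE; rewrite -leNgt.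
(* Passing to [n.+1] terms allows the term at 0 to be split off even when [n] is 0. *)
have wS : \sum_(i < n) level w i <= \sum_(i < n.+1) level w i.
  by rewrite big_ord_recr lerDl; apply: sumr_ge0 => z' _; apply: sumr_ge0.
have := v1 n.+1; move: wS; rewrite !big_ord_recl.
have : \sum_(i < n) level w (lift ord0 i) <= \sum_(i < n) level v (lift ord0 i).
  by apply: ler_sum.
lra.
Qed.

End Orbit_chain.

(** * Evaluation of sums of finitely many point masses over arbitrary sets *)

Section Finite_esum.
Context {R : realType} {T : choiceType}.
Implicit Types (A : set T) (f g : T -> R) (c d : R).

(** Nonnegativity is bundled with the value because additivity of [esum] relies on it. *)
Definition sums_to A f c :=
  (forall x, A x -> 0 <= f x) /\ (\esum_(x in A) (f x)%:E = c%:E)%E.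

Lemma eq_sums_to A f g c :
  (forall x, A x -> f x = g x) -> sums_to A f c -> sums_to A g c.
Proof.
move=> fg [f0 fc]; split=> [x Ax|]; first by rewrite -fg ?f0.
by rewrite -fc; apply: eq_esum => x Ax; rewrite fg.
Qed.

Lemma sums_toD A f g c d :
  sums_to A f c -> sums_to A g d -> sums_to A (fun x => f x + g x) (c + d).
Proof.
move=> [f0 fc] [g0 gd]; split=> [x Ax|]; first by rewrite addr_ge0 ?f0 ?g0.
by rewrite EFinD -fc -gd -esumD// => x Ax; rewrite lee_fin ?f0 ?g0.
Qed.

Lemma sums_to_big (I : Type) (l : seq I) (p : pred I) A (f : I -> T -> R)
    (c : I -> R) :
  (forall i, p i -> sums_to A (f i) (c i)) ->
  sums_to A (fun x => \sum_(i <- l | p i) f i x) (\sum_(i <- l | p i) c i).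
Proof.
move=> fc; have s0 : sums_to A (fun=> 0) 0 by split=> //; exact: esum1.
elim: l => [|i l IH].
  by rewrite big_nil; apply: eq_sums_to s0 => x _; rewrite big_nil.
rewrite big_cons; case: ifPn => pi.
  apply: eq_sums_to (sums_toD (fc _ pi) IH) => x _.
  by rewrite big_cons pi.
by apply: eq_sums_to IH => x _; rewrite big_cons (negbTE pi).
Qed.

(** The guard [b] serves transitions that exist only conditionally: [t] has to lie in [A] only when
    the transition is present. *)
Lemma sums_to_point A c (b : bool) t : 0 <= c -> (b -> A t) ->
  sums_to A (fun x => c * (b && (x == t))%:R) (c * b%:R).
Proof.
move=> c0 At; split=> [x _|]; first by rewrite mulr_ge0.
case: b At => [/(_ isT) At|_] /=; last first.
  by rewrite esum1 ?mulr0// => x _; rewrite mulr0.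
rewrite (esumID [set t]); last by move=> x _; rewrite lee_fin mulr_ge0.
rewrite [X in (_ + X)%E]esum1 ?adde0; last first.
  by move=> x [_ /eqP /negbTE ->]; rewrite mulr0.
rewrite (_ : A `&` [set t] = [set t]); last first.
  by apply/seteqP; split=> [x []//|x ->].
by rewrite esum_set1 ?eqxx// lee_fin mulr_ge0.
Qed.

Lemma sums_to_point1 A c t : 0 <= c -> A t ->
  sums_to A (fun x => c * (x == t)%:R) c.
Proof.
move=> c0 At; rewrite -[X in sums_to _ _ X]mulr1.
exact: (@sums_to_point A c true).
Qed.

End Finite_esum.

Lemma sum_point (R : pzRingType) (I : eqType) (l : seq I) (p : pred I)
    (F : I -> R) (b : bool) (k : I) : uniq l ->
  \sum_(i <- l | p i) F i * (b && (k == i))%:R =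
  F k * [&& b, k \in l & p k]%:R.
Proof.
move=> ul; case: b => /=; last by rewrite mulr0 big1// => i _; rewrite mulr0.
rewrite big_mkcond/=; have [kl|kl] := boolP (k \in l).
  rewrite (bigD1_seq k)//= eqxx big1 ?addr0 => [|i].
    by case: (p k); rewrite ?mulr0.
  by rewrite eq_sym => /negbTE ->; rewrite mulr0 if_same.
rewrite big1_seq ?mulr0// => i /= il.
have -> : (k == i) = false by apply: contraNF kl => /eqP ->.
by rewrite mulr0 if_same.
Qed.

Lemma sum_point_fin (R : pzRingType) (I : finType) (p : pred I)
    (F : I -> R) (b : bool) (k : I) :
  \sum_(i | p i) F i * (b && (k == i))%:R = F k * (b && p k)%:R.
Proof. by rewrite sum_point ?index_enum_uniq// mem_index_enum. Qed.

(** * Summing a steady state over the inventory levels *)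

Section Marginal.
Context {R : realType} {m : nat} (e : environment R m).
Hypothesis he : valid_environment e.
Variables (s S : nat).
Hypothesis sS : (s < S)%N.

Local Notation Q := (env_gen e).

(** The inventory level drops out: for [s < i] exactly one of the two service transitions is
    present. The retrial guard is absorbed by the factor [r%:R]. *)
Lemma exit_rateE r i st z : (s < i <= S)%N ->
  exit_rate (rate e s S) (r, i, st, z) = outflow e r st z.
Proof.
move=> /[dup] isS /andP[si iS].
suff [_ H] : sums_to (~` [set (r, i, st, z)]) (rate e s S (r, i, st, z))
    (outflow e r st z) by rewrite /exit_rate H.
have a0 := ltW (arrival_gt0 he z); have s0 := ltW (service_gt0 he z).
have f0 := ltW (failure_gt0 he z); have p0 := ltW (repair_gt0 he z).
have t0 : 0 <= r%:R * retrial e z by rewrite mulr_ge0// ltW// retrial_gt0.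
rewrite /rate isS /outflow; apply: sums_toD.
  apply: sums_to_big => z' zz'; apply: sums_to_point1.
    by rewrite gen_ge0// eq_sym.
  by case=> zz; rewrite zz eqxx in zz'.
case: st => /=.
- apply: sums_toD; last by apply: sums_to_point1.
  apply: sums_toD; last by apply: sums_to_point1.
  have tE : r%:R * retrial e z * (0 < r)%N%:R = r%:R * retrial e z.
    by case: (r) => [|?]; rewrite ?mulr1// !mul0r.
  by rewrite -[X in sums_to _ _ X]tE; apply: sums_to_point.
- apply: sums_toD; last by apply: sums_to_point1 => //; case; lia.
  apply: sums_toD; last by apply: sums_to_point1.
  have sE : service e z * (s.+1 < i)%N%:R + service e z * (i == s.+1)%:R =
      service e z.
    by have [?|?|?] := ltngtP i s.+1; rewrite ?mulr1 ?mulr0 ?addr0 ?add0r//;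
      lia.
  by rewrite -[X in sums_to _ _ X]sE; apply: sums_toD; apply: sums_to_point.
- apply: sums_toD; last by apply: sums_to_point1 => //; case; lia.
  by apply: sums_to_point1.
Qed.


Variable P : state m -> R.
Hypothesis P0 : forall x, 0 <= P x.

(** The rates are reorganized by target: each kind of transition into the given state has at most
    one source, and the guards say when it exists. Level [S] is reached by service from [s.+1], any
    lower level from [i.+1]. *)
Lemma rate_inflowE r i st z x : (s < i <= S)%N ->
  \sum_(z' | z' != z) P (r, i, st, z') * Q z' z * (x == (r, i, st, z'))%:R +
  match st with
  | idle =>
      P (r, i.+1, busy, z) * service e z *
        ((i < S)%N && (x == (r, i.+1, busy, z)))%:R
      + P (r, s.+1, busy, z) * service e z *
        ((i == S) && (x == (r, s.+1, busy, z)))%:R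
      + P (r, i, failed, z) * repair e z * (x == (r, i, failed, z))%:R
  | busy =>
      P (r.+1, i, idle, z) * (r.+1%:R * retrial e z) *
        (x == (r.+1, i, idle, z))%:R
      + P (r, i, idle, z) * arrival e z * (x == (r, i, idle, z))%:R
      + P (r.-1, i, busy, z) * arrival e z *
        ((0 < r)%N && (x == (r.-1, i, busy, z)))%:R
  | failed =>
      P (r, i, idle, z) * failure e z * (x == (r, i, idle, z))%:R
      + P (r.-1, i, busy, z) * failure e z *
        ((0 < r)%N && (x == (r.-1, i, busy, z)))%:R
      + P (r.-1, i, failed, z) * arrival e z *
        ((0 < r)%N && (x == (r.-1, i, failed, z)))%:R
  end = P x * rate e s S x (r, i, st, z).
Proof.
move=> isS; case: x => [[[r' i'] st'] z'].
rewrite /rate.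
have srvE : ((idle == idle) * (busy == busy) * (failed == failed))%type.
  by [].
have srvN : ((idle == busy = false) * (idle == failed = false) *
  (busy == idle = false) * (busy == failed = false) *
  (failed == idle = false) * (failed == busy = false))%type by [].
(* Coefficients need to agree only where the indicator is true, since its equalities identify the
   two states. *)
have termE (b1 b2 : bool) (c1 c2 d1 d2 : R) : b1 = b2 ->
    (b1 -> c1 * d1 = c2 * d2) -> c1 * d1 * b1%:R = c2 * (d2 * b2%:R).
  by move=> <-; case: b1 => [|_]; [rewrite mulrA => ->|rewrite mulr0n !mulr0].
have srv := (srvE, srvN).
(* The cases are the nine pairs of statuses, each split by whether the environments agree and
   whether the source level is in range. *)
case: st; case: st'; rewrite !xpair_eqE ?srv;
  under eq_bigr do rewrite ?xpair_eqE ?srv;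
  under [in RHS] eq_bigr do rewrite ?xpair_eqE ?srv;
  rewrite ?sum_point_fin (eq_sym z' z); have [zz|zz] := eqVneq z z';
  rewrite /= ?andbF ?andbT ?mulr0n ?mulr0 ?addr0 ?add0r -?andbA;
  rewrite ?andbF ?mulr0n ?mulr0 ?addr0 ?add0r ?if_same ?mulr0//;
  (have [g|g] := ifP); rewrite ?mulr0 ?mulrDr//.
all: try (congr (_ + _)); try (apply: termE; [lia|]).
all: do 2?[match goal with |- context[(_ * ?b%:R)] =>
  have -> : b = false by lia end; rewrite ?mulr0n ?mulr0 ?add0r//].
all: rewrite ?zz.
all: by [case/and3P => ? /eqP-> /eqP->|case/and3P => /eqP-> /eqP->|
  case/andP => /eqP-> /eqP->].
Qed.

Lemma sums_to_rate_inflow r i st z : (s < i <= S)%N ->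
  sums_to (~` [set (r, i, st, z)]) (fun x => P x * rate e s S x (r, i, st, z))
    (\sum_(z' | z' != z) P (r, i, st, z') * Q z' z +
     match st with
     | idle =>
         P (r, i.+1, busy, z) * service e z * (i < S)%N%:R
         + P (r, s.+1, busy, z) * service e z * (i == S)%:R
         + P (r, i, failed, z) * repair e z
     | busy =>
         P (r.+1, i, idle, z) * (r.+1%:R * retrial e z)
         + P (r, i, idle, z) * arrival e z
         + P (r.-1, i, busy, z) * arrival e z * (0 < r)%N%:R
     | failed =>
         P (r, i, idle, z) * failure e z
         + P (r.-1, i, busy, z) * failure e z * (0 < r)%N%:R
         + P (r.-1, i, failed, z) * arrival e z * (0 < r)%N%:R
     end).
Proof.
move=> isS; apply: (eq_sums_to (fun x _ => rate_inflowE r st z x isS)).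
have a0 := ltW (arrival_gt0 he z); have s0 := ltW (service_gt0 he z).
have f0 := ltW (failure_gt0 he z); have p0 := ltW (repair_gt0 he z).
have t0 : 0 <= r.+1%:R * retrial e z by rewrite mulr_ge0// ltW// retrial_gt0.
apply: sums_toD.
  apply: sums_to_big => z' zz'; apply: sums_to_point1.
    by rewrite mulr_ge0// gen_ge0.
  by case=> zz; rewrite zz eqxx in zz'.
case: st => /=.
- apply: sums_toD; last by apply: sums_to_point1 => //; exact: mulr_ge0.
  by apply: sums_toD; apply: sums_to_point => //; exact: mulr_ge0.
- apply: sums_toD; last first.
    by apply: sums_to_point; [exact: mulr_ge0|move=> r0; case; lia].
  by apply: sums_toD; apply: sums_to_point1 => //; exact: mulr_ge0.
- apply: sums_toD; last first.
    by apply: sums_to_point; [exact: mulr_ge0|move=> r0; case; lia].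
  by apply: sums_toD; [apply: sums_to_point1|apply: sums_to_point] => //;
    exact: mulr_ge0.
Qed.

Definition marginal (r : nat) (st : server) (z : 'I_m) : R :=
  \sum_(s.+1 <= i < S.+1) P (r, i, st, z).

Lemma marginal_ge0 r st z : 0 <= marginal r st z.
Proof. by apply: sumr_ge0. Qed.

Lemma marginal_before r st z c :
  \sum_(s.+1 <= i < S.+1) P (r.-1, i, st, z) * c * (0 < r)%N%:R =
  before marginal r st z * c.
Proof.
case: r => [|r] /=; last by under eq_bigr do rewrite mulr1; rewrite mulr_suml.
by rewrite mul0r big1// => i _; rewrite mulr0.
Qed.

(** The thresholds disappear here: service with replenishment permutes the levels [s.+1], ..., [S]
    cyclically, so summing over targets counts each source level once. *)
Lemma marginal_service r z c :
  \sum_(s.+1 <= i < S.+1) (P (r, i.+1, busy, z) * c * (i < S)%N%:R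
    + P (r, s.+1, busy, z) * c * (i == S)%:R) = marginal r busy z * c.
Proof.
rewrite big_nat_recr//= ltnn eqxx mulr0 add0r mulr1.
rewrite /marginal [X in _ = X * _]big_ltn// [in RHS]big_add1/= mulrDl addrC.
rewrite mulr_suml.
congr (_ + _); apply: eq_big_nat => i /andP[_ iS].
by rewrite iS (ltn_eqF iS) mulr1 mulr0 addr0.
Qed.

Hypothesis steadyP : steady_state (rate e s S) (@state_space s S m) P.

Lemma balanced_marginal : balanced e marginal.
Proof.
move=> r st z; rewrite /marginal mulr_suml.
transitivity (\sum_(s.+1 <= i < S.+1) 
  fine (\esum_(x in ~` [set (r, i, st, z)])
    (P x * rate e s S x (r, i, st, z))%:E)).
  apply: eq_big_nat => i isS; case: steadyP => _ _ _ <-.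
  by rewrite exit_rateE.
under eq_big_nat => i isS do rewrite (sums_to_rate_inflow r st z isS).2.
rewrite big_split/= exchange_big/= /inflow; congr (_ + _).
  by apply: eq_bigr => z' _; rewrite mulr_suml.
by case: st; rewrite /= !big_split/= ?marginal_before -?mulr_suml//
  -big_split marginal_service.
Qed.

(** The slice is infinite, as its inventory coordinate is any natural number, but [P] vanishes
    outside the range and is there a finite sum of point masses. *)
Lemma sums_to_level r :
  sums_to [set x : state m | x.1.1.1 = r] P (level marginal r).
Proof.
have : sums_to [set x : state m | x.1.1.1 = r]
  (fun x => \sum_z \sum_st \sum_(s.+1 <= i < S.+1)
    P (r, i, st, z) * (x == (r, i, st, z))%:R) (level marginal r).
  apply: sums_to_big => z _; apply: sums_to_big => st _.
  by apply: sums_to_big => i _; exact: sums_to_point1.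
apply: eq_sums_to => -[[[r' i'] st'] z'] /= ->.
pose b := i' \in index_iota s.+1 S.+1.
transitivity (\sum_z \sum_st P (r, i', st, z) *
    ((b && (z' == z)) && (st' == st))%:R).
  apply: eq_bigr => z _; apply: eq_bigr => st _.
  transitivity (\sum_(s.+1 <= i < S.+1) P (r, i, st, z) *
      (((z' == z) && (st' == st)) && (i' == i))%:R).
    apply: eq_bigr => i _; rewrite !xpair_eqE eqxx/=.
    by rewrite andbC -andbA [(st' == st) && _]andbC.
  by rewrite sum_point ?iota_uniq// andbT andbC -/b andbA.
under eq_bigr do rewrite sum_point_fin andbT.
rewrite sum_point_fin andbT.
have [ib|/negP ib] := boolP b; first by rewrite mulr1.
case: steadyP => _ Pout _ _; rewrite Pout ?mul0r//= => isS.
by apply: ib; rewrite /b mem_index_iota.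
Qed.

Lemma level_series : (\sum_(0 <= r <oo) (level marginal r)%:E = 1)%E.
Proof.
case: steadyP => _ _ <- _.
have -> : [set: state m] = \bigcup_r [set x : state m | x.1.1.1 = r].
  by apply/seteqP; split=> // x _; exists x.1.1.1.
rewrite nneseries_sum_bigcup => [|i j _ _ [x [<- <-]]//|x]; last first.
  by rewrite lee_fin.
by apply: eq_eseriesr => r _; rewrite (sums_to_level r).2.
Qed.

Lemma level_ge0 r : 0 <= level marginal r.
Proof. by do 2?[apply: sumr_ge0 => ? _]; exact: marginal_ge0. Qed.

Lemma level_partial_le n : \sum_(r < n) level marginal r <= 1.
Proof.
rewrite -lee_fin -level_series -(big_mkord xpredT) -sumEFin.
by apply: nneseries_lim_ge => r _ _; rewrite lee_fin level_ge0.
Qed.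

Lemma level_partial_gt eps :
  0 < eps -> exists n, 1 - eps < \sum_(r < n) level marginal r.
Proof.
move=> eps0; apply: contrapT => /forallNP H.
suff : (1 <= (1 - eps)%:E)%E by rewrite lee_fin; lra.
rewrite -level_series; apply: lime_le.
  by apply: is_cvg_nneseries => r _ _; rewrite lee_fin level_ge0.
apply: nearW => n; rewrite sumEFin lee_fin big_mkord leNgt; apply/negP.
exact: H.
Qed.

Lemma orbit_probE r : orbit_prob s S P r = level marginal r.
Proof.
rewrite /orbit_prob /level exchange_big/= [RHS]exchange_big.
by apply: eq_bigr => st _; exact: exchange_big.
Qed.

(** By propagation of positivity, one zero entry would make all entries zero, against total mass
    1. *)
Lemma marginal_gt0 r st z : 0 < marginal r st z.
Proof.
rewrite ltNge; apply/negP => le0.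
have [//|n] := @level_partial_gt 1; rewrite subrr ltNge => /negP; apply.
apply: sumr_le0 => r' _; apply: sumr_le0 => z' _; apply: sumr_le0 => st' _.
rewrite leNgt; apply/negP => gt0; move: le0; apply/negP; rewrite -ltNge.
by apply: (balanced_gt0 he _ balanced_marginal gt0) => *; exact: marginal_ge0.
Qed.

Lemma busy_probE : busy_prob s S P =
  fine (\sum_(0 <= r <oo) (\sum_z marginal r busy z)%:E)%E.
Proof.
by congr fine; apply: eq_eseriesr => r _; rewrite exchange_big.
Qed.

Lemma mean_orbit_sizeE : mean_orbit_size s S P =
  fine (\sum_(0 <= r <oo) (r%:R * level marginal r)%:E)%E.
Proof. by congr fine; apply: eq_eseriesr => r _; rewrite orbit_probE. Qed.

Lemma busy_prob_gt0 : (0 < m)%N -> 0 < busy_prob s S P.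
Proof.
move=> m0; rewrite busy_probE.
have B0 r : 0 <= \sum_z marginal r busy z.
  by apply: sumr_ge0 => z _; exact: marginal_ge0.
apply: fine_gt0; apply/andP; split.
  apply: (@lt_le_trans _ _ (\sum_(0 <= r < 1) (\sum_z marginal r busy z)%:E)%E).
    rewrite big_nat1 lte_fin (bigD1 (Ordinal m0))//= ltr_pwDl ?marginal_gt0//.
    by apply: sumr_ge0 => z _; exact: marginal_ge0.
  by apply: nneseries_lim_ge => r _ _; rewrite lee_fin.
(* As [fine] sends [+oo] to 0, positivity also requires finiteness, obtained by comparison with the
   total mass. *)
apply: (@le_lt_trans _ _ 1%E); last exact: ltry.
rewrite -level_series; apply: lee_nneseries => [r _|r _]; rewrite lee_fin//.
apply: ler_sum => z _; rewrite sum_server.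
by have := marginal_ge0 r idle z; have := marginal_ge0 r failed z; lra.
Qed.

Lemma mean_orbit_size_ge0 : 0 <= mean_orbit_size s S P.
Proof.
rewrite mean_orbit_sizeE fine_ge0// nneseries_ge0// => r _ _.
by rewrite lee_fin mulr_ge0// level_ge0.
Qed.

End Marginal.

Lemma marginal_le (R : realType) (m : nat) (e : environment R m)
    (s S s' S' : nat) (P P' : state m -> R) :
  valid_environment e -> (s < S)%N -> (s' < S')%N ->
  steady_state (rate e s S) (@state_space s S m) P ->
  steady_state (rate e s' S') (@state_space s' S' m) P' ->
  forall r st z, marginal s S P r st z <= marginal s' S' P' r st z.
Proof.
move=> he sS sS' hP hP'; have [P0 _ _ _] := hP; have [P0' _ _ _] := hP'.
exact: (balanced_le he (marginal_ge0 _ _ P0) (marginal_ge0 _ _ P0')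
  (balanced_marginal he sS P0 hP) (balanced_marginal he sS' P0' hP')
  (level_partial_le P0 hP) (level_partial_gt P0' hP')).
Qed.

Lemma marginal_unique (R : realType) (m : nat) (e : environment R m)
    (s S s' S' : nat) (P P' : state m -> R) :
  valid_environment e -> (s < S)%N -> (s' < S')%N ->
  steady_state (rate e s S) (@state_space s S m) P ->
  steady_state (rate e s' S') (@state_space s' S' m) P' ->
  marginal s S P = marginal s' S' P'.
Proof.
move=> he sS sS' hP hP'.
apply/funext => r; apply/funext => st; apply/funext => z.
by apply: le_anti; rewrite (marginal_le he sS sS' hP hP')
  (marginal_le he sS' sS hP' hP).
Qed.

(** * Minimizers and integer rounding of the cost *)

Lemma argmin_set_sub (R : realType) (T : Type) (f : T -> R) (A B : set T) :
  B `<=` A -> (forall t, A t -> ~ B t -> exists2 b, B b & f b < f t) ->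
  argmin_set f A = argmin_set f B.
Proof.
move=> BA AB; apply/seteqP; split=> t [].
  move=> At min_t; split=> [|t' /BA]; last exact: min_t.
  apply: contrapT => Bt; have [b /BA Ab] := AB _ At Bt.
  by rewrite ltNge min_t.
move=> Bt min_t; split=> [|t' At']; first exact: BA.
have [/min_t//|Bt'] := pselect (B t').
have [b Bb /ltW] := AB _ At' Bt'.
exact/le_trans/min_t.
Qed.

(** Only a tie between two distinct candidates can break uniqueness, and the disjunction excludes
    it. *)
Lemma argmin_set2_unique (R : realType) (T : Type) (f : T -> R) (x y : T) :
  x = y \/ f x <> f y -> exists! t, argmin_set f [set x; y] t.
Proof.
wlog xy : x y / f x <= f y.
  move=> H neq; have [/H{}H|/ltW/H{}H] := leP (f x) (f y); first exact: H neq.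
  by rewrite setUC; apply: H; case: neq => [|/nesym]; [left|right].
move=> neq; exists x; split=> [|t [[->//|tE] min_t]].
  by split=> [|t' [|] ->//]; left.
case: neq => [->//|[]]; apply/eqP; rewrite eq_le xy -tE min_t//.
by left.
Qed.

Section Rounding.
Context {R : realType} (a : nat) (alpha beta : R).
Hypotheses (alpha_gt0 : 0 < alpha) (beta_gt0 : 0 < beta).

(** The classical economic-order-quantity cost for lot size [n - a], with real minimizer [x]. In
    [lo], the maximum keeps the lot size positive when the floor of [x] is [a]. *)
Let f (n : nat) : R := alpha * (n%:R - a%:R) + beta / (n%:R - a%:R).
Let x : R := a%:R + Num.sqrt (beta / alpha).
Let lo := maxn a.+1 `|Num.floor x|%N.
Let hi := `|Num.ceil x|%N.

Lemma eoq_lt (n k : nat) : (a < n)%N -> (a < k)%N ->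
  0 < (n%:R - k%:R) * ((n%:R - a%:R) * (k%:R - a%:R) - beta / alpha) ->
  f k < f n.
Proof.
move=> an ak gt0; rewrite -subr_gt0.
have n0 : 0 < n%:R - a%:R :> R by rewrite subr_gt0 ltr_nat.
have k0 : 0 < k%:R - a%:R :> R by rewrite subr_gt0 ltr_nat.
have -> : f n - f k = (n%:R - k%:R) *
    ((n%:R - a%:R) * (k%:R - a%:R) - beta / alpha) *
    (alpha / ((n%:R - a%:R) * (k%:R - a%:R))).
  by rewrite /f; field; rewrite !gt_eqF.
by rewrite mulr_gt0// divr_gt0// mulr_gt0.
Qed.

(** Put [q = sqrt (beta / alpha)]. Above [hi], the product of the lot sizes of [n] and [hi] exceeds
    [q * q]; below [lo], that of [n] and [lo] is smaller. [eoq_lt] applies in both cases. *)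
Lemma eoq_rounding :
  [/\ (a < lo)%N, (a < hi)%N &
      forall n, (a < n)%N -> n <> lo -> n <> hi -> f lo < f n \/ f hi < f n].
Proof.
set q := Num.sqrt (beta / alpha).
have q0 : 0 < q by rewrite sqrtr_gt0 divr_gt0.
have qq : beta / alpha = q * q by rewrite -expr2 sqr_sqrtr// ltW// divr_gt0.
have x0 : 0 <= x by rewrite addr_ge0// ltW.
have fl0 : 0 <= Num.floor x by rewrite floor_ge0.
have ce0 : 0 <= Num.ceil x by rewrite ceil_ge0 (lt_le_trans _ x0)// ltrN10.
have loE : `|Num.floor x|%N%:R <= x < `|Num.floor x|%N%:R + 1.
  by rewrite natr_absz ger0_norm// -intrD1 floor_itv.
have hiE : hi%:R - 1 < x <= hi%:R.
  by rewrite natr_absz ger0_norm// -(intrB _ _ 1) ceil_itv.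
have xE : x = a%:R + q by [].
have alo : (a < lo)%N by rewrite leq_max leqnn.
have ahi : (a < hi)%N by rewrite -(ltr_nat R); lra.
split=> // n an nlo nhi.
have n0 : 0 < n%:R - a%:R :> R by rewrite subr_gt0 ltr_nat.
have k0 : 0 < lo%:R - a%:R :> R by rewrite subr_gt0 ltr_nat.
have [nhi'|hin] := leqP n hi; [left|right]; apply: eoq_lt => //; last first.
  have hn : hi%:R < n%:R :> R by rewrite ltr_nat.
  rewrite mulr_gt0// subr_gt0// qq.
  by apply: (@le_lt_trans _ _ (q * (hi%:R - a%:R)));
    [rewrite ler_pM2l//|rewrite ltr_pM2r]; lra.
have n_hi : (n < hi)%N by rewrite ltn_neqAle nhi' andbT; apply/eqP.
(* Ceiling and floor differ by at most 1, so [n < hi] puts [n] at or below the floor; equality would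
   make [n] equal to [lo]. *)
have n_fl : (n < `|Num.floor x|)%N.
  have : hi%:R < `|Num.floor x|%N.+2%:R :> R by rewrite -!natr1; lra.
  by rewrite ltr_nat; move: nlo; rewrite /lo; lia.
have lo_fl : lo = `|Num.floor x|%N by rewrite /lo; lia.
have nlo' : n%:R < lo%:R :> R by rewrite lo_fl ltr_nat.
rewrite nmulr_rgt0 ?subr_lt0// qq.
by apply: (@le_lt_trans _ _ ((n%:R - a%:R) * q));
  [rewrite ler_pM2l//|rewrite ltr_pM2r//]; move: nlo'; rewrite lo_fl; lra.
Qed.

End Rounding.

Lemma mean_arrival_rate_gt0 (R : realType) (m : nat) (e : environment R m)
    (p : 'rV[R]_m) :
  valid_environment e -> stationary_vector (env_gen e) p ->
  0 < mean_arrival_rate e p.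
Proof.
move=> he [p0 p1 _]; rewrite lt_neqAle eq_sym andbC sumr_ge0 => [|z _] /=.
  rewrite psumr_neq0 => [|z _]; last by rewrite mulr_ge0// ltW// arrival_gt0.
  have : \sum_z p 0 z != 0 by rewrite p1 oner_neq0.
  rewrite psumr_neq0// => /hasP[z zi /= pz]; apply/hasP; exists z => //=.
  by rewrite mulr_gt0// arrival_gt0.
by rewrite mulr_ge0// ltW// arrival_gt0.
Qed.

(** * Independence of the performance measures from the thresholds *)

Section Cost.
Context {R : realType} {m : nat} (e : environment R m) (p : 'rV[R]_m).
Context (s S s' S' : nat) (P P' : state m -> R).
Hypotheses (he : valid_environment e) (hp : stationary_vector (env_gen e) p).
Hypotheses (sS : (s < S)%N) (sS' : (s' < S')%N).
Hypothesis hP : steady_state (rate e s S) (@state_space s S m) P.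
Hypothesis hP' : steady_state (rate e s' S') (@state_space s' S' m) P'.

Lemma mean_orbit_size_unique : mean_orbit_size s S P = mean_orbit_size s' S' P'.
Proof. by rewrite !mean_orbit_sizeE (marginal_unique he sS sS' hP hP'). Qed.

Lemma mean_sojourn_unique :
  mean_sojourn e p s S P = mean_sojourn e p s' S' P'.
Proof.
rewrite /mean_sojourn /mean_number mean_orbit_size_unique.
by rewrite !busy_probE (marginal_unique he sS sS' hP hP').
Qed.

Lemma mean_sojourn_gt0 : (0 < m)%N -> 0 < mean_sojourn e p s S P.
Proof.
have [P0 _ _ _] := hP; move=> m0.
rewrite divr_gt0 ?mean_arrival_rate_gt0// ltr_wpDl ?mean_orbit_size_ge0//.
exact: (busy_prob_gt0 he sS P0 hP m0).
Qed.

End Cost.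

Theorem theorem3 (R : realType) (m : nat) (hm : (1 <= m)%N)
    (e : environment R m) (he : valid_environment e)
    (p : 'rV[R]_m) (hp : stationary_vector (env_gen e) p)
    (a : nat)
    (hrec : forall s S : nat, feasible a (s, S) ->
       forall x : state m, state_space s S x ->
       positive_recurrent (rate e s S) x)
    (P : nat -> nat -> state m -> R)
    (hP : forall s S : nat, feasible a (s, S) ->
       steady_state (rate e s S) (@state_space s S m) (P s S))
    (s0 S0 : nat) (h0 : feasible a (s0, S0)) :
  let Ch : R := 5 in let Cb : R := 24 in
  let Co : R := 11 in let Cp : R := 2 in
  let CT := total_cost Ch Cb Co Cp e p P in
  (* W does not depend on the thresholds: any feasible (s0, S0) may be used *)
  let W := mean_sojourn e p s0 S0 (P s0 S0) in
  let Sbar := a%:R + Num.sqrt (2 * Co / (Ch * W)) in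
  let lo := (a, maxn a.+1 `|Num.floor Sbar|%N) in
  let hi := (a, `|Num.ceil Sbar|%N) in
  argmin_set CT (feasible a) = argmin_set CT [set lo; hi]
  /\ (lo = hi \/ CT lo <> CT hi ->
      exists! t : nat * nat, argmin_set CT (feasible a) t).
Proof.
move=> Ch Cb Co Cp CT W Sbar lo hi.
have {h0} [/= s0a aS0] := h0; subst s0.
have hP0 := hP _ _ (conj erefl aS0 : feasible a (a, S0)).
have W0 : 0 < W by exact: (mean_sojourn_gt0 he hp aS0 hP0 hm).
pose alpha : R := Ch / 2; pose beta := Co / W.
have alpha0 : 0 < alpha by rewrite divr_gt0 ?ltr0n.
have beta0 : 0 < beta by rewrite divr_gt0// ltr0n.
pose f n : R := alpha * (n%:R - a%:R) + beta / (n%:R - a%:R).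
(* The first term is what remains of the holding cost: [(a + n + 1) / 2 = (n - a) / 2 + (a + 1 /
   2)]. *)
pose c : R := Ch * (a%:R + 2^-1) + Cb * mean_orbit_size a S0 (P a S0) + Cp / W.
have CTE n : (a < n)%N -> CT (a, n) = f n + c.
  move=> an; have hPn := hP _ _ (conj erefl an : feasible a (a, n)).
  rewrite /CT /total_cost/= (mean_sojourn_unique p he an aS0 hPn hP0).
  rewrite (mean_orbit_size_unique he an aS0 hPn hP0) -/W.
  have n0 : n%:R - a%:R != 0 :> R by rewrite subr_eq0 eqr_nat gtn_eqF.
  by rewrite /f /c /alpha /beta; field; rewrite n0 gt_eqF.
have [alo ahi lo_hi] := eoq_rounding a alpha0 beta0.
have SbarE : a%:R + Num.sqrt (beta / alpha) = Sbar.
  congr (_ + Num.sqrt _); rewrite /beta /alpha; field.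
  by rewrite gt_eqF.
rewrite SbarE -/f in alo ahi lo_hi.
have -> : argmin_set CT (feasible a) = argmin_set CT [set lo; hi].
  apply: argmin_set_sub => [t [|] ->//|[b n] [/= -> an] ntlohi].
  have [||ltf|ltf] := lo_hi n an.
  - by move=> nE; apply: ntlohi; left; rewrite /lo nE.
  - by move=> nE; apply: ntlohi; right; rewrite /hi nE.
  - by exists lo; [left|rewrite !CTE// ltrD2r].
  - by exists hi; [right|rewrite !CTE// ltrD2r].
by split=> //; exact: argmin_set2_unique.
Qed.
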